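(* Let $A\in\mathbb{R}^{m\times n}$ and let $X\subseteq\mathbb{R}^n$ be a convex set that contains more than one point. (a) If $\mathbb{R}^m$ is endowed with the Euclidean norm, $D(y,x)=\frac12\|y-x\|^2$ for some norm $\|\cdot\|$ in $\mathbb{R}^n$, and $f(x)=\frac12\|Ax-b\|_2^2$ for some $b\in\mathbb{R}^m$, then \[ L_{f,X,D}=\|A|\mathrm{span}(X-X)\|^2. \] (b) Suppose $\mathbb{R}^m$, $\mathbb{R}^n$ are endowed with norms and $D:X\times X\to\mathbb{R}_+$ is a distance-like function with $D(y,x)\ge\frac12\|y-x\|^2$ for all $x,y\in X$, for the norm in $\mathbb{R}^n$. If $f=g\circ A$ with $X\subseteq\mathrm{dom}(f)$, where $g:\mathbb{R}^m\to\mathbb{R}\cup\{\infty\}$ is convex, differentiable and $L_g$-smooth for the norm in $\mathbb{R}^m$, then \[ L_{f,X,D}\le L_g\,\|A|\mathrm{span}(X-X)\|^2. \]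
   Context: Distance-like: $D(y,x)\ge 0$ and $D(x,x)=0$ for all $x,y\in X$. Bregman distance: $D_f(y,x)=f(y)-f(x)-\langle\nabla f(x),y-x\rangle$. The relative smoothness constant is \[ L_{f,X,D}:=\inf\{L>0:\ D_f(y,x)\le L\,D(y,x)\text{ for all }x,y\in X\}. \] $g$ is $L_g$-smooth for $\|\cdot\|$ if $D_g(v,u)\le\frac{L_g}{2}\|v-u\|^2$ for all $u,v\in\mathrm{dom}(g)$. $\mathrm{span}(X-X)$ is the linear subspace spanned by $X-X=\{x-y:x,y\in X\}$. For a convex cone (in particular a linear subspace) $C\subseteq\mathbb{R}^n$, $\|A|C\|:=\sup_{x\in C,\,\|x\|\le1}\|Ax\|$, computed with the given norms on $\mathbb{R}^n$ and $\mathbb{R}^m$. *)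

(* Defs.v *)
From HB Require Import structures.
From mathcomp Require Import all_boot all_order all_algebra.
From mathcomp Require Import all_classical all_reals all_analysis.

Set Implicit Arguments.
Unset Strict Implicit.
Unset Printing Implicit Defensive.

Import Order.TTheory GRing.Theory Num.Theory.
Import numFieldNormedType.Exports.

Local Open Scope classical_set_scope.
Local Open Scope ring_scope.

Section Defs.
Context {R : realType}.

(* Vectors of R^n are column vectors 'cV[R]_n.  The canonical norm of that type
   is the max norm; it only enters the definitions below through the topology
   of R^n and through [is_gradient].  The norms of the statement are explicit
   functions satisfying [is_norm]. *)
Definition is_norm n (N : 'cV[R]_n -> R) : Prop :=
  [/\ forall x y, N (x + y) <= N x + N y,
      forall a x, N (a *: x) = `|a| * N x &
      forall x, N x = 0 -> x = 0].

Definition dotv n (u v : 'cV[R]_n) : R := \sum_(i < n) u i 0 * v i 0.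

Definition enorm n (u : 'cV[R]_n) : R := Num.sqrt (dotv u u).

Definition edom n (f : 'cV[R]_n -> \bar R) : set 'cV[R]_n :=
  [set x | (f x < +oo)%E].

Definition econvex n (f : 'cV[R]_n -> \bar R) : Prop :=
  forall (x y : 'cV[R]_n) (t : R), 0 <= t <= 1 ->
    (f (t *: x + (1 - t) *: y)%R <= t%:E * f x + (1 - t)%:E * f y)%E.

(* f v = f x + <p, v - x> + o(v - x) as v tends to x inside the domain of f.
   At an interior point of the domain this is Frechet differentiability (see
   [is_gradientP]) and p is the usual gradient.  At a boundary point p need not
   be unique, but when f is convex <p, v - x> is the one-sided directional
   derivative of f at x, hence does not depend on p, for every v in the
   domain. *)
Definition is_gradient n (f : 'cV[R]_n -> \bar R) (x p : 'cV[R]_n) : Prop :=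
  forall e : R, 0 < e -> \forall v \near x, edom f v ->
    `|fine (f v) - fine (f x) - dotv p (v - x)| <= e * `|v - x|.

Lemma dotv_is_linear n (p : 'cV[R]_n) : linear (dotv p : 'cV[R]_n -> R^o).
Proof.
move=> a u v; rewrite /dotv scaler_sumr -big_split /=.
by apply: eq_bigr => i _; rewrite !mxE mulrDr /GRing.scale /= mulrCA.
Qed.

HB.instance Definition _ n (p : 'cV[R]_n) :=
  GRing.isLinear.Build R 'cV[R]_n R^o _ (dotv p) (dotv_is_linear p).

Lemma dotv_continuous n (p : 'cV[R]_n) : continuous (dotv p : 'cV[R]_n -> R^o).
Proof.
move=> x; have Fx := nbhs_filter x; rewrite /continuous_at /dotv.
apply: (cvg_big (@add_continuous R^o)) => i _.
by apply: cvgM; [exact: cvg_cst|exact: coord_continuous].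
Qed.

Lemma is_gradientP n (f : 'cV[R]_n -> \bar R) (x p : 'cV[R]_n) :
  (edom f)^° x ->
  is_gradient f x p <->
  differentiable (fine \o f : _ -> R^o) x /\
  'd (fine \o f : _ -> R^o) x = dotv p :> ('cV[R]_n -> R^o).
Proof.
move=> fx.
have key : is_gradient f x p <->
    (fine \o f : _ -> R^o) \o shift x =
      cst (fine (f x) : R^o) + (dotv p : 'cV[R]_n -> R^o) +o_ (0 : 'cV[R]_n) id.
  have E e : (\forall v \near x, edom f v ->
        `|fine (f v) - fine (f x) - dotv p (v - x)| <= e * `|v - x|) <->
      (\forall h \near (0 : 'cV[R]_n),
        `|fine (f (h + x)) - (fine (f x) + dotv p h)| <= e * `|h|).
    rewrite (near_shift 0) subr0; split; last first.
      by apply: filterS => v + _; rewrite /= addrK opprD addrA.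
    have : \forall v \near x, edom f v by exact: fx.
    rewrite (near_shift 0) subr0; apply: filterS2 => v fv /(_ fv).
    by rewrite /= addrK opprD addrA.
  by split=> [gp|/eqaddoP gp e e0]; [apply/eqaddoP => e e0|];
    apply/E; exact: gp.
rewrite key; split=> [gp|[/diff_locally fd <-]] //.
have dE := diff_unique (@dotv_continuous n p) gp.
split=> //; apply/diff_locallyP; rewrite dE; split=> //.
exact: dotv_continuous.
Qed.

Definition grad n (f : 'cV[R]_n -> \bar R) (x : 'cV[R]_n) : 'cV[R]_n :=
  get (is_gradient f x).

Definition edifferentiable n (f : 'cV[R]_n -> \bar R) : Prop :=
  forall x, edom f x -> exists p, is_gradient f x p.

Definition bregman n (f : 'cV[R]_n -> \bar R) (y x : 'cV[R]_n) : \bar R :=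
  (f y - f x - (dotv (grad f x) (y - x)%R)%:E)%E.

Definition smooth_for n (N : 'cV[R]_n -> R) (L : R)
    (g : 'cV[R]_n -> \bar R) : Prop :=
  forall u v, edom g u -> edom g v ->
    (bregman g v u <= (L / 2 * N (v - u) ^+ 2)%:E)%E.

Definition distance_like n (X : set 'cV[R]_n)
    (D : 'cV[R]_n -> 'cV[R]_n -> R) : Prop :=
  forall x y, X x -> X y -> 0 <= D y x /\ D x x = 0.

Definition rel_smooth_const n (f : 'cV[R]_n -> \bar R) (X : set 'cV[R]_n)
    (D : 'cV[R]_n -> 'cV[R]_n -> R) : \bar R :=
  ereal_inf [set L%:E | L in [set L : R | 0 < L /\
    forall x y, X x -> X y -> (bregman f y x <= (L * D y x)%:E)%E]].

(* Linear span of an arbitrary set, from the library's span of sequences. *)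
Definition lspan n (S : set 'cV[R]_n) : set 'cV[R]_n :=
  [set v | exists2 s : seq 'cV[R]_n,
     (forall w, w \in s -> S w) & v \in span s].

Definition diffset n (X : set 'cV[R]_n) : set 'cV[R]_n :=
  [set z | exists x y, [/\ X x, X y & z = x - y]].

Definition opnorm_on m n (Nm : 'cV[R]_m -> R) (Nn : 'cV[R]_n -> R)
    (A : 'M[R]_(m, n)) (C : set 'cV[R]_n) : \bar R :=
  ereal_sup [set (Nm (A *m x))%:E | x in [set x | C x /\ Nn x <= 1]].

End Defs.

(* Main.v *)
(* The Bregman distance of g o A is that of g transported by A: A^T grad g(A x)
   is a gradient of g o A at x, and two gradients at x agree on y - x as soon
   as the segment from x to y stays in the domain.  For half the squared
   Euclidean distance to b it is |A (y - x)|^2 / 2, and in (b) it is at most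
   L_g |A (y - x)|^2 / 2.  Since X is convex, span(X - X) consists of the
   multiples t (x - y) with x, y in X, so bounding |A (y - x)| by r |y - x| on X
   is the same as bounding the operator norm on the span by r.  No compactness
   is needed: an infinite operator norm makes both sides of (a) infinite. *)
Require Import Defs.
From mathcomp Require Import all_boot all_order all_algebra.
From mathcomp Require Import all_classical all_reals all_analysis.
From mathcomp Require Import ring lra.
Set Implicit Arguments.
Unset Strict Implicit.
Unset Printing Implicit Defensive.

Import Order.TTheory GRing.Theory Num.Theory.
Import numFieldNormedType.Exports.
Local Open Scope classical_set_scope.
Local Open Scope ring_scope.

(** * Norm estimates on R^n and the adjoint identity *)

Section Vectors.
Context {R : realType}.
Implicit Types m n : nat.

Lemma norm_entry_le n (u : 'cV[R]_n) i : `|u i 0| <= `|u|.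
Proof.
rewrite [leRHS]mx_normrE.
exact: (le_bigmax _ (fun ij : 'I_n * 'I_1 => `|u ij.1 ij.2|) (i, 0)).
Qed.

(** The sum of all absolute entries of [A] bounds each row sum; one is added so that the constant
    can be divided by even when [A] is zero. *)
Lemma norm_mulmx_bounded m n (A : 'M[R]_(m, n)) :
  exists2 c : R, 0 < c & forall v : 'cV[R]_n, `|A *m v| <= c * `|v|.
Proof.
pose c := \sum_i \sum_j `|A i j|.
have c_ge0 : 0 <= c by do 2![apply: sumr_ge0 => ? _].
exists (c + 1) => [|v]; first by rewrite ltr_wpDl.
rewrite [leLHS]mx_normrE; apply: bigmax_le => [|[i j] _ /=].
  by rewrite mulr_ge0// addr_ge0.
rewrite ord1 mxE (le_trans (ler_norm_sum _ _ _))//.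
apply: (@le_trans _ _ ((\sum_k `|A i k|) * `|v|)).
  rewrite mulr_suml; apply: ler_sum => k _.
  by rewrite normrM ler_wpM2l// norm_entry_le.
rewrite ler_wpM2r//; apply: (@le_trans _ _ c); last by rewrite lerDl.
rewrite /c (bigD1 i)//= lerDl.
by do 2![apply: sumr_ge0 => ? _].
Qed.

Lemma dotv_adj m n (A : 'M[R]_(m, n)) (p : 'cV[R]_m) (v : 'cV[R]_n) :
  dotv (A^T *m p) v = dotv p (A *m v).
Proof.
have dotvE k (a b : 'cV[R]_k) : dotv a b = (a^T *m b) 0 0.
  by rewrite mxE; apply: eq_bigr => i _; rewrite mxE.
by rewrite !dotvE trmx_mul trmxK mulmxA.
Qed.

Lemma dotvv_ge0 n (u : 'cV[R]_n) : 0 <= dotv u u.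
Proof. by apply: sumr_ge0 => i _; rewrite -expr2 sqr_ge0. Qed.

Lemma sqr_enorm n (u : 'cV[R]_n) : enorm u ^+ 2 = dotv u u.
Proof. by rewrite sqr_sqrtr// dotvv_ge0. Qed.

Lemma enormZ n (a : R) (u : 'cV[R]_n) : enorm (a *: u) = `|a| * enorm u.
Proof.
rewrite /enorm -sqrtr_sqr -sqrtrM ?sqr_ge0//; congr Num.sqrt.
by rewrite mulr_sumr; apply: eq_bigr => i _; rewrite !mxE; ring.
Qed.

Lemma dotvv_le_norm n (u : 'cV[R]_n) : dotv u u <= n%:R * `|u| ^+ 2.
Proof.
apply: (@le_trans _ _ (\sum_(i < n) `|u| ^+ 2)); last first.
  by rewrite sumr_const card_ord mulr_natl.
apply: ler_sum => i _.
by rewrite -expr2 -real_normK ?num_real// lerXn2r ?nnegrE ?norm_entry_le.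
Qed.

Lemma is_norm0 n (N : 'cV[R]_n -> R) : is_norm N -> N 0 = 0.
Proof. by case=> _ NZ _; rewrite -[X in N X](scale0r 0) NZ normr0 mul0r. Qed.

Lemma is_norm_ge0 n (N : 'cV[R]_n -> R) (x : 'cV[R]_n) : is_norm N -> 0 <= N x.
Proof.
move=> Nn; have [ND NZ _] := Nn; have := ND x (- x).
by rewrite subrr is_norm0// -scaleN1r NZ normrN normr1 mul1r; lra.
Qed.

End Vectors.

(** * Gradients relative to the domain: chain rule, behaviour along segments, convexity *)

Section Gradients.
Context {R : realType}.
Implicit Types m n : nat.

Lemma is_gradient_deltaP n (f : 'cV[R]_n -> \bar R) (x p : 'cV[R]_n) :
  is_gradient f x p <->
  forall e, 0 < e -> exists2 d, 0 < d & forall v, `|v - x| < d -> edom f v ->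
    `|fine (f v) - fine (f x) - dotv p (v - x)| <= e * `|v - x|.
Proof.
split=> fp e e0; have := fp e e0.
  move/nbhs_normP => [d /= d0 H]; exists d => // v vx.
  by apply: H; rewrite /= distrC.
move=> [d d0 H]; apply/nbhs_normP; exists d => //= v vx.
by apply: H; rewrite distrC.
Qed.

(** Chain rule: an error [e / c * |A (v - x)|] for [g] is at most [e * |v - x|], where [c] bounds
    [A]. The domain of the composite is the preimage of the domain of [g]. *)
Lemma is_gradient_mulmx m n (A : 'M[R]_(m, n)) (g : 'cV[R]_m -> \bar R)
    (x : 'cV[R]_n) (p : 'cV[R]_m) :
  is_gradient g (A *m x) p ->
  is_gradient (fun v => g (A *m v)) x (A^T *m p).
Proof.
have [c c0 Ac] := norm_mulmx_bounded A.
move=> /is_gradient_deltaP gp; apply/is_gradient_deltaP => e e0.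
have [d d0 gd] := gp _ (divr_gt0 e0 c0).
exists (d / c) => [|v vx fv]; first by rewrite divr_gt0.
rewrite dotv_adj mulmxBr.
have AB : `|A *m v - A *m x| <= c * `|v - x| by rewrite -mulmxBr.
rewrite (le_trans (gd _ _ _))//.
  by rewrite (le_lt_trans AB)// mulrC -ltr_pdivlMr.
by rewrite -mulrA (ler_pM2l e0) ler_pdivrMl.
Qed.

Lemma is_gradient_dir n (f : 'cV[R]_n -> \bar R) (x p h : 'cV[R]_n) :
  is_gradient f x p ->
  (forall t, 0 < t <= 1 -> edom f (x + t *: h)) ->
  forall e, 0 < e -> exists2 d, 0 < d & forall t, 0 < t < d -> t <= 1 ->
    `|fine (f (x + t *: h)) - fine (f x) - t * dotv p h| <= e * t.
Proof.
move=> /is_gradient_deltaP fp seg e e0.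
(* Adding one keeps the divisor positive when [h] is zero. *)
have h1 : 0 < `|h| + 1 by rewrite ltr_wpDl.
have [d d0 fd] := fp _ (divr_gt0 e0 h1).
exists (d / (`|h| + 1)) => [|t /andP[t0 td] t1]; first by rewrite divr_gt0.
have xt : x + t *: h - x = t *: h by rewrite addrC addKr.
have := fd (x + t *: h); rewrite xt normrZ (gtr0_norm t0).
have -> : dotv p (t *: h) = t * dotv p h by exact: linearZ.
move=> fdt; apply: (le_trans (fdt _ _)).
- have : t * (`|h| + 1) < d by rewrite -ltr_pdivlMr.
  by apply: le_lt_trans; rewrite ler_pM2l// lerDl.
- by apply: seg; rewrite t0.
- by rewrite -mulrA (ler_pM2l e0) mulrCA ger_pMr// ler_pdivrMl// mulr1 lerDl.
Qed.

(** Both numbers are the limit of the same difference quotient along [h]. Hence the arbitrary choice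
    made by [grad] at a boundary point is harmless along segments in the domain. *)
Lemma dotv_grad_uniq n (f : 'cV[R]_n -> \bar R) (x p q h : 'cV[R]_n) :
  is_gradient f x p -> is_gradient f x q ->
  (forall t, 0 < t <= 1 -> edom f (x + t *: h)) ->
  dotv p h = dotv q h.
Proof.
move=> fp fq seg; apply/eqP; rewrite -subr_eq0 -normr_le0.
apply/ler_addgt0Pr => e e0; rewrite add0r.
have e2 : 0 < e / 2 by rewrite divr_gt0.
have [d1 d10 H1] := is_gradient_dir fp seg e2.
have [d2 d20 H2] := is_gradient_dir fq seg e2.
pose t := Num.min 1 (Num.min (d1 / 2) (d2 / 2)).
have t0 : 0 < t by rewrite /t !lt_min ltr01 !divr_gt0.
have t1 : t <= 1 by rewrite /t ge_min lexx.
have td1 : t < d1 by rewrite /t !gt_min; apply/orP; right; apply/orP; left; lra.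
have td2 : t < d2 by rewrite /t !gt_min; apply/orP; right; apply/orP; right; lra.
have {}H1 := H1 t; rewrite t0 td1 in H1; have {}H1 := H1 isT t1.
have {}H2 := H2 t; rewrite t0 td2 in H2; have {}H2 := H2 isT t1.
(* Scaled by [t], the gap between the two inner products is at most the sum of two errors
   [e / 2 * t]. *)
rewrite -(ler_pM2l t0) -{1}(gtr0_norm t0) -normrM.
move: H1 H2; rewrite !ler_norml => /andP[? ?] /andP[? ?].
by apply/andP; split; lra.
Qed.

Lemma bregman_grad n (f : 'cV[R]_n -> \bar R) (x y p : 'cV[R]_n) :
  is_gradient f x p ->
  (forall t, 0 < t <= 1 -> edom f (x + t *: (y - x))) ->
  bregman f y x = (f y - f x - (dotv p (y - x)%R)%:E)%E.
Proof.
move=> fp seg; rewrite /bregman (@dotv_grad_uniq _ f x (grad f x) p)//.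
by apply: getPex; exists p.
Qed.

Lemma segmentE n (x y : 'cV[R]_n) (t : R) :
  x + t *: (y - x) = t *: y + (1 - t) *: x.
Proof. by apply/colP => i; rewrite !mxE; ring. Qed.

(** The convexity inequality bounds the value by two terms, each shown to be below [+oo]. The value
    [-oo] is allowed; at [t = 1] its product with the zero weight is 0. *)
Lemma econvex_edom n (f : 'cV[R]_n -> \bar R) (x y : 'cV[R]_n) :
  econvex f -> edom f x -> edom f y ->
  forall t, 0 < t <= 1 -> edom f (x + t *: (y - x)).
Proof.
move=> cf fx fy t /andP[t0 t1]; rewrite /edom /= segmentE.
apply: le_lt_trans (cf _ _ _ _) _; first by rewrite t1 ltW.
apply: lte_add_pinfty.
  by move: fy; rewrite /edom/=; case: (f y) => [r _| |]//=;
    rewrite ?ltry// gt0_muleNy ?lte_fin.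
move: fx; rewrite /edom/=; case: (f x) => [r _| |]//=; first by rewrite ltry.
have [->|t1'] := eqVneq t 1; first by rewrite subrr mul0e.
by rewrite gt0_muleNy// lte_fin subr_gt0 lt_neqAle t1'.
Qed.

(* Dividing g(u + t(v - u)) <= (1 - t) g(u) + t g(v) by t and letting t go to
   0 gives the gradient inequality. *)
Lemma econvex_grad_ge n (g : 'cV[R]_n -> \bar R) (u v p : 'cV[R]_n) :
  (forall w, g w <> -oo%E) -> econvex g -> edom g u -> edom g v ->
  is_gradient g u p -> dotv p (v - u) <= fine (g v) - fine (g u).
Proof.
move=> gNy cg gu gv gp.
have gfin w : edom g w -> (fine (g w))%:E = g w.
  by have := gNy w; rewrite /edom /=; case: (g w).
apply/ler_addgt0Pr => e e0.
have seg := econvex_edom cg gu gv.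
have [d d0 H] := is_gradient_dir gp seg e0.
pose t := Num.min 1 (d / 2).
have t0 : 0 < t by rewrite /t !lt_min ltr01 !divr_gt0.
have t1 : t <= 1 by rewrite /t ge_min lexx.
have td : t < d by rewrite /t !gt_min; apply/orP; right; lra.
have {}H := H t; rewrite t0 td in H; have {}H := H isT t1.
have t01 : 0 <= t <= 1 by rewrite t1 ltW.
have tseg : 0 < t <= 1 by rewrite t0.
have := cg v u t t01; rewrite -segmentE.
rewrite -(gfin _ gu) -(gfin _ gv) -(gfin _ (seg t tseg)).
rewrite -!EFinM -EFinD lee_fin => cvx.
rewrite -(ler_pM2l t0).
by move: H; rewrite ler_norml => /andP[? ?]; lra.
Qed.

End Gradients.

(** * Spans of differences, operator norms and relative smoothness constants *)

Section RelativeSmoothness.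
Context {R : realType}.
Implicit Types m n : nat.

Lemma lspan0 n (S : set 'cV[R]_n) : lspan S 0.
Proof. by exists [::] => //; exact: mem0v. Qed.

Lemma lspanZ n (S : set 'cV[R]_n) (a : R) z : lspan S z -> lspan S (a *: z).
Proof. by move=> [s Ss zs]; exists s => //; exact: memvZ. Qed.

Lemma sub_lspan n (S : set 'cV[R]_n) : S `<=` lspan S.
Proof.
move=> z Sz; exists [:: z] => [w|]; first by rewrite inE => /eqP ->.
by apply: memv_span; rewrite inE.
Qed.

(* The differences x - y of points of a convex set form a symmetric convex
   set, so the cone they generate is already a linear subspace. *)
Lemma lspan_diffset n (X : set 'cV[R]_n) (z : 'cV[R]_n) :
  convex_set X -> X !=set0 -> lspan (diffset X) z ->
  exists t x y, [/\ 0 <= t, X x, X y & z = t *: (x - y)].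
Proof.
move=> cX [x0 Xx0] [s]; elim: s z => [|w s IHs] z Ss.
  rewrite span_nil memv0 => /eqP ->.
  by exists 0, x0, x0; split; rewrite // scale0r.
have Xconv (a b t : R) (x y : 'cV[R]_n) : 0 <= a -> 0 <= b -> 0 < a + b ->
    X x -> X y -> X ((a / (a + b)) *: x + (b / (a + b)) *: y).
  move=> a0 b0 ab0 Xx Xy.
  have i0 : 0 <= a / (a + b) by rewrite divr_ge0 ?addr_ge0.
  have i1 : a / (a + b) <= 1 by rewrite ler_pdivrMr// mul1r lerDl.
  have -> : b / (a + b) = 1 - a / (a + b) by field; exact: lt0r_neq0.
  exact: set_mem (cX x y (Itv01 i0 i1) (mem_set Xx) (mem_set Xy)).
rewrite span_cons => /memv_addP[u /vlineP[k ->] [v vs ->]].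
have [|t [x [y [t0 Xx Xy ->]]]] := IHs v _ vs.
  by move=> w' w's; apply: Ss; rewrite inE w's orbT.
have [x' [y' [Xx' Xy' ->]]] := Ss w (mem_head _ _).
(* Exchanging [x'] and [y'] changes the sign of the coefficient. *)
wlog k0 : k x' y' Xx' Xy' / 0 <= k.
  move=> H; have [|/ltW k0] := leP 0 k; first exact: H.
  have -> : k *: (x' - y') = (- k) *: (y' - x') by rewrite scaleNr -scalerN opprB.
  by apply: H => //; rewrite oppr_ge0.
have := addr_ge0 k0 t0; rewrite le_eqVlt => /orP[/eqP kt0|kt0].
  have -> : k = 0 by lra.
  have -> : t = 0 by lra.
  by exists 0, x0, x0; split; rewrite // !scale0r addr0.
(* The sum [k (x' - y') + t (x - y)] regroups as [k + t] times the difference of two weighted means,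
   both taken with the weights [k / (k + t)] and [t / (k + t)]. *)
exists (k + t), ((k / (k + t)) *: x' + (t / (k + t)) *: x),
  ((k / (k + t)) *: y' + (t / (k + t)) *: y).
split; [exact: ltW|exact: Xconv|exact: Xconv|].
by apply/colP => i; rewrite !mxE; field; exact: lt0r_neq0.
Qed.

Lemma opnorm_on_ge0 m n (Nm : 'cV[R]_m -> R) (Nn : 'cV[R]_n -> R)
    (A : 'M[R]_(m, n)) (S : set 'cV[R]_n) :
  is_norm Nn -> (forall u, 0 <= Nm u) ->
  (0 <= opnorm_on Nm Nn A (lspan S))%E.
Proof.
move=> Nn_norm Nm0; apply: (@le_trans _ _ (Nm (A *m 0))%:E).
  by rewrite lee_fin.
apply: ereal_sup_ubound; exists 0 => //; split; first exact: lspan0.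
by rewrite is_norm0.
Qed.

(** Rescaling a nonzero [z] to norm one places it among the competitors of the supremum. *)
Lemma opnorm_on_bound m n (Nm : 'cV[R]_m -> R) (Nn : 'cV[R]_n -> R)
    (A : 'M[R]_(m, n)) (S : set 'cV[R]_n) (r : R) (z : 'cV[R]_n) :
  is_norm Nn -> (forall a u, Nm (a *: u) = `|a| * Nm u) ->
  opnorm_on Nm Nn A (lspan S) = r%:E -> lspan S z ->
  Nm (A *m z) <= r * Nn z.
Proof.
move=> Nn_norm NmZ Ar Sz; have [_ NnZ Nn_eq0] := Nn_norm.
have [->|z0] := eqVneq z 0.
  by rewrite mulmx0 is_norm0// mulr0 -(scale0r (0 : 'cV_m)) NmZ normr0 mul0r.
have Nz : 0 < Nn z.
  rewrite lt_neqAle is_norm_ge0// andbT eq_sym.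
  by apply: contra_neq z0; exact: Nn_eq0.
rewrite -ler_pdivrMr// -lee_fin -Ar; apply: ereal_sup_ubound.
exists ((Nn z)^-1 *: z).
  split; first exact: lspanZ.
  by rewrite NnZ gtr0_norm ?invr_gt0// mulVf ?gt_eqF.
by rewrite -scalemxAr NmZ gtr0_norm ?invr_gt0// mulrC.
Qed.

(** Each element of the span is a nonnegative multiple of a difference of points of [X], and both
    sides of the bound scale by that multiple. *)
Lemma opnorm_on_le m n (Nm : 'cV[R]_m -> R) (Nn : 'cV[R]_n -> R)
    (A : 'M[R]_(m, n)) (X : set 'cV[R]_n) (r : R) :
  convex_set X -> X !=set0 -> 0 <= r ->
  is_norm Nn -> (forall a u, Nm (a *: u) = `|a| * Nm u) ->
  (forall x y, X x -> X y -> Nm (A *m (y - x)) <= r * Nn (y - x)) ->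
  (opnorm_on Nm Nn A (lspan (diffset X)) <= r%:E)%E.
Proof.
move=> cX X0 r0 [_ NnZ _] NmZ bnd; apply: ge_ereal_sup => _ [z [Xz z1] <-].
have [t [x [y [t0 Xx Xy zE]]]] := lspan_diffset cX X0 Xz.
rewrite lee_fin (@le_trans _ _ (r * Nn z))//; last by rewrite ler_piMr.
by rewrite zE -scalemxAr NmZ NnZ mulrCA ler_wpM2l// bnd.
Qed.

(** The infimum ranges over positive constants only, so [c], which may be 0, is approached through
    [c + e]. *)
Lemma rel_smooth_const_le n (f : 'cV[R]_n -> \bar R) (X : set 'cV[R]_n)
    (D : 'cV[R]_n -> 'cV[R]_n -> R) (c : R) :
  0 <= c -> (forall x y, X x -> X y -> 0 <= D y x) ->
  (forall x y, X x -> X y -> (bregman f y x <= (c * D y x)%:E)%E) ->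
  (rel_smooth_const f X D <= c%:E)%E.
Proof.
move=> c0 D0 fD; apply/lee_addgt0Pr => e e0.
apply: ereal_inf_lbound; exists (c + e); last by rewrite EFinD.
split=> [|x y Xx Xy]; first by rewrite ltr_wpDl.
by rewrite (le_trans (fD _ _ Xx Xy))// lee_fin ler_wpM2r ?D0// lerDl ltW.
Qed.

(** Upper bound shared by (a), with [c = 1], and by (b) for nonnegative [Lg], with [c = Lg]. *)
Lemma rel_smooth_const_le_opnorm m n (A : 'M[R]_(m, n))
    (f : 'cV[R]_n -> \bar R) (X : set 'cV[R]_n)
    (D : 'cV[R]_n -> 'cV[R]_n -> R)
    (Nm : 'cV[R]_m -> R) (Nn : 'cV[R]_n -> R) (c : R) :
  is_norm Nn -> (forall a u, Nm (a *: u) = `|a| * Nm u) ->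
  (forall u, 0 <= Nm u) -> 0 <= c ->
  (forall x y, X x -> X y -> 2^-1 * Nn (y - x) ^+ 2 <= D y x) ->
  (forall x y, X x -> X y ->
    (bregman f y x <= (c / 2 * Nm (A *m (y - x)) ^+ 2)%:E)%E) ->
  (rel_smooth_const f X D
    <= c%:E * opnorm_on Nm Nn A (lspan (diffset X)) ^+ 2)%E.
Proof.
move=> Nn_norm NmZ Nm0 c0 DN fN.
have D0 x y : X x -> X y -> 0 <= D y x.
  by move=> Xx Xy; apply: le_trans (DN _ _ Xx Xy); rewrite mulr_ge0 ?sqr_ge0.
have := opnorm_on_ge0 A (diffset X) Nn_norm Nm0.
case Ar: (opnorm_on _ _ _ _) => [r| |] //; last first.
  (* With an infinite operator norm, a positive [c] makes the right side infinite. For [c = 0] the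
     product is 0 by convention, and the Bregman distances are then at most 0 themselves. *)
  move=> _; have [c00|c_neq0] := eqVneq c 0; last first.
    by rewrite expe2 mulyy gt0_muley ?leey// lte_fin lt_neqAle eq_sym c_neq0.
  rewrite c00 mul0e; apply: rel_smooth_const_le => // x y Xx Xy.
  by rewrite (le_trans (fN _ _ Xx Xy))// c00 !mul0r.
rewrite lee_fin => r0; rewrite -EFin_expe -EFinM.
apply: rel_smooth_const_le => // [|x y Xx Xy].
  by rewrite mulr_ge0 ?sqr_ge0.
rewrite (le_trans (fN _ _ Xx Xy))// lee_fin.
have Nr : Nm (A *m (y - x)) <= r * Nn (y - x).
  by apply: opnorm_on_bound Ar _ => //; apply: sub_lspan; exists y, x.
have {}Nr : Nm (A *m (y - x)) ^+ 2 <= (r * Nn (y - x)) ^+ 2.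
  by rewrite lerXn2r ?nnegrE// mulr_ge0 ?is_norm_ge0.
(* The factor 1/2 passes from [c] to the squared norm, where [D] dominates. *)
apply: (@le_trans _ _ (c * r ^+ 2 * (2^-1 * Nn (y - x) ^+ 2))); last first.
  by rewrite ler_wpM2l ?DN// mulr_ge0 ?sqr_ge0.
apply: (@le_trans _ _ (c / 2 * (r * Nn (y - x)) ^+ 2)).
  by rewrite ler_wpM2l// divr_ge0.
by rewrite le_eqVlt; apply/orP; left; apply/eqP; field.
Qed.

(** * Bregman distances of composites with [A] and of the quadratic *)

Lemma bregman_mulmx m n (A : 'M[R]_(m, n)) (g : 'cV[R]_m -> \bar R)
    (x y : 'cV[R]_n) (p : 'cV[R]_m) :
  is_gradient g (A *m x) p ->
  (forall t, 0 < t <= 1 -> edom g (A *m x + t *: (A *m y - A *m x))) ->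
  bregman (fun v => g (A *m v)) y x = bregman g (A *m y) (A *m x).
Proof.
move=> gp seg; rewrite (bregman_grad gp seg).
rewrite (bregman_grad (is_gradient_mulmx gp)) => [|t t01].
  by rewrite dotv_adj mulmxBr.
by have := seg t t01; rewrite /edom /= mulmxDr -scalemxAr mulmxBr.
Qed.

(** The remainder is exactly half the squared Euclidean length of [v - u], hence at most [m] times
    its squared max norm. The radius uses [m + 1] to cover dimension zero. *)
Lemma is_gradient_half_sqr_dist m (b u : 'cV[R]_m) :
  is_gradient (fun w => (2^-1 * enorm (w - b) ^+ 2)%:E) u (u - b).
Proof.
apply/is_gradient_deltaP => e e0.
have m1 : 0 < m%:R + 1 :> R by rewrite ltr_wpDl.
exists (e / (m%:R + 1)) => [|v vu _ /=]; first by rewrite divr_gt0.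
rewrite !sqr_enorm.
have -> : 2^-1 * dotv (v - b) (v - b) - 2^-1 * dotv (u - b) (u - b)
    - dotv (u - b) (v - u) = 2^-1 * dotv (v - u) (v - u).
  rewrite /dotv !mulr_sumr -!sumrB; apply: eq_bigr => i _.
  by rewrite !mxE; field.
have vv := dotvv_le_norm (v - u).
rewrite ger0_norm ?mulr_ge0 ?dotvv_ge0//.
have n0 := normr_ge0 (v - u); move: vu; rewrite ltr_pdivlMr// => vu.
have d0 := dotvv_ge0 (v - u).
apply: (@le_trans _ _ (m%:R * `|v - u| ^+ 2)); first by lra.
rewrite expr2 mulrA ler_wpM2r//; lra.
Qed.

Lemma bregman_half_sqr_dist m n (A : 'M[R]_(m, n)) (b : 'cV[R]_m)
    (x y : 'cV[R]_n) :
  bregman (fun v => (2^-1 * enorm (A *m v - b) ^+ 2)%:E) y x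
  = (2^-1 * enorm (A *m (y - x)) ^+ 2)%:E.
Proof.
have gp := is_gradient_half_sqr_dist b (A *m x).
rewrite (bregman_mulmx (g := fun w => (2^-1 * enorm (w - b) ^+ 2)%:E) gp).
  rewrite (bregman_grad gp) => [|t _]; last exact: ltry.
  rewrite -!EFinB !sqr_enorm mulmxBr; congr (_%:E).
  rewrite /dotv !mulr_sumr -!sumrB; apply: eq_bigr => i _.
  by rewrite !mxE; field.
by move=> t _; exact: ltry.
Qed.

End RelativeSmoothness.

Theorem proposition2 (R : realType) (m n : nat) (A : 'M[R]_(m, n))
    (X : set 'cV[R]_n) (convX : convex_set X)
    (X2 : exists x y : 'cV[R]_n, [/\ X x, X y & x <> y]) :
  (forall (Nn : 'cV[R]_n -> R) (b : 'cV[R]_m), is_norm Nn ->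
     rel_smooth_const
       (fun x => (2^-1 * enorm (A *m x - b) ^+ 2)%:E)
       X
       (fun y x => 2^-1 * Nn (y - x) ^+ 2)
     = (opnorm_on (@enorm R m) Nn A (lspan (diffset X)) ^+ 2)%E)
  /\
  (forall (Nm : 'cV[R]_m -> R) (Nn : 'cV[R]_n -> R)
     (D : 'cV[R]_n -> 'cV[R]_n -> R) (g : 'cV[R]_m -> \bar R) (Lg : R),
     is_norm Nm -> is_norm Nn ->
     distance_like X D ->
     (forall x y, X x -> X y -> 2^-1 * Nn (y - x) ^+ 2 <= D y x) ->
     (forall u, g u <> -oo%E) ->
     econvex g -> edifferentiable g -> smooth_for Nm Lg g ->
     X `<=` edom (fun x => g (A *m x)) ->
     (rel_smooth_const (fun x => g (A *m x)) X D
      <= Lg%:E * opnorm_on Nm Nn A (lspan (diffset X)) ^+ 2)%E).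
Proof.
have X0 : X !=set0 by case: X2 => x [y [Xx _ _]]; exists x.
split=> [Nn b Nn_norm|Nm Nn D g Lg Nm_norm Nn_norm _ DN gNy cg dg smg Xg].
  have en0 (u : 'cV[R]_m) : 0 <= enorm u by exact: sqrtr_ge0.
  apply/eqP; rewrite eq_le; apply/andP; split.
    rewrite -[leRHS]mul1e; apply: rel_smooth_const_le_opnorm => //.
    - exact: enormZ.
    - by move=> x y _ _; rewrite bregman_half_sqr_dist mul1r.
  (* Lower bound: an admissible [L] satisfies [|A (y - x)|^2 <= L |y - x|^2] on [X], so [Num.sqrt L]
     bounds the operator norm on the span, and squaring gives the claim. *)
  apply: le_ereal_inf_tmp => _ [L [L0 LD] <-].
  have : (opnorm_on (@enorm R m) Nn A (lspan (diffset X))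
      <= (Num.sqrt L)%:E)%E.
    apply: opnorm_on_le => //; [exact: enormZ|move=> x y Xx Xy].
    have := LD x y Xx Xy; rewrite bregman_half_sqr_dist lee_fin => LDxy.
    have Nyx := is_norm_ge0 (y - x) Nn_norm.
    rewrite -(@ler_pXn2r _ 2)// ?nnegrE ?mulr_ge0 ?sqrtr_ge0//.
    by rewrite exprMn (sqr_sqrtr (ltW L0)); lra.
  rewrite -lee_sqr ?lee_fin ?sqrtr_ge0 ?opnorm_on_ge0//.
  by rewrite -EFin_expe sqr_sqrtr// ltW.
have [_ NmZ _] := Nm_norm.
have Nm0 u : 0 <= Nm u by exact: is_norm_ge0.
have gfin u : edom g u -> (fine (g u))%:E = g u.
  by have := gNy u; rewrite /edom /=; case: (g u).
have fg x y : X x -> X y ->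
    bregman (fun v => g (A *m v)) y x = bregman g (A *m y) (A *m x).
  move=> /Xg gx /Xg gy; have [p gp] := dg _ gx.
  by apply: bregman_mulmx gp _; exact: econvex_edom.
have fN x y : X x -> X y ->
    (bregman (fun v => g (A *m v)) y x
      <= (Lg / 2 * Nm (A *m (y - x)) ^+ 2)%:E)%E.
  by move=> Xx Xy; rewrite fg// mulmxBr; apply: smg; exact: Xg.
have [Lg0|Lg0] := leP 0 Lg; first exact: rel_smooth_const_le_opnorm fN.
(* Bregman distances of the convex g are nonnegative, so a negative Lg forces
   A to vanish on X - X. *)
have AX0 x y : X x -> X y -> Nm (A *m (y - x)) = 0.
  move=> Xx Xy; have [gx gy] := (Xg _ Xx, Xg _ Xy).
  have [p gp] := dg _ gx.
  have := econvex_grad_ge gNy cg gx gy gp.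
  have := smg _ _ gx gy.
  rewrite (bregman_grad gp (econvex_edom cg gx gy)).
  rewrite -(gfin _ gx) -(gfin _ gy) -!EFinB lee_fin mulmxBr => le1 le2.
  apply/eqP; rewrite -sqrf_eq0 eq_le sqr_ge0 andbT.
  by rewrite -(ler_nM2l Lg0); lra.
have -> : opnorm_on Nm Nn A (lspan (diffset X)) = 0%E.
  apply/eqP; rewrite eq_le opnorm_on_ge0// andbT.
  by apply: opnorm_on_le => // x y Xx Xy; rewrite AX0// mul0r.
(* The right side is now 0, and smoothness bounds every Bregman distance on [X] by 0. *)
rewrite expe2 !mule0; apply: rel_smooth_const_le => // [x y Xx Xy|x y Xx Xy].
  by apply: le_trans (DN _ _ Xx Xy); rewrite mulr_ge0 ?sqr_ge0.
by rewrite (le_trans (fN _ _ Xx Xy))// AX0// expr0n/= mulr0 mul0r.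
Qed.
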